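(* Let $\mathcal{C}$ be a class of unital and nuclear $C^*$-algebras. If $A$ in $\mathcal{C}$ is such that (i) $A^{\otimes\infty}\cong A$, and (ii) $B^{\otimes\infty}\otimes A\cong B^{\otimes\infty}$ for every $B$ in $\mathcal{C}$, then $A$ is unique up to $*$-isomorphism; that is, any two members of $\mathcal{C}$ which both satisfy (i) and (ii) are $*$-isomorphic.
   Context: For a unital nuclear $C^*$-algebra $A$, $A^{\otimes\infty}$ denotes the infinite tensor product of countably many copies of $A$, i.e. the inductive limit of the tensor powers $A^{\otimes k}$ under the unital embeddings $a\mapsto a\otimes 1_A$. *)

(* Defs.v *)
From HB Require Import structures.
From mathcomp Require Import all_boot all_order all_algebra.
From mathcomp Require Import generic_quotient complex ring lra.
From mathcomp Require Import boolp classical_sets functions reals topology.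
From mathcomp Require Import normedtype sequences.
Set Implicit Arguments.
Unset Strict Implicit.
Unset Printing Implicit Defensive.
Import Order.TTheory GRing.Theory Num.Theory.
Import numFieldNormedType.Exports.
Local Open Scope classical_set_scope.
Local Open Scope ring_scope.
Local Open Scope complex_scope.
Local Notation Re := complex.Re.

Reserved Notation "x ** y" (at level 40, left associativity).

(* Nuclearity is tested against C*-algebras without unit, and a unital        *)
(* C*-algebra may be zero, whereas the algebras of the library have a unit    *)
(* 1 != 0; hence the product amul, distinct from the ring product.            *)
HB.mixin Record Lmodule_isStarAlgebra (R : realType) A
    of GRing.Lmodule R[i] A := {
  amul : A -> A -> A;
  star : A -> A;
  amulA : associative amul;
  amulDl : left_distributive amul +%R;
  amulDr : right_distributive amul +%R;
  amulZl : forall (l : R[i]) x y, amul (l *: x) y = l *: amul x y;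
  amulZr : forall (l : R[i]) x y, amul x (l *: y) = l *: amul x y;
  starK : involutive star;
  starD : {morph star : x y / x + y};
  starZ : forall (l : R[i]) x, star (l *: x) = conjc l *: star x;
  starM : forall x y, star (amul x y) = amul (star y) (star x)
}.

#[short(type="starAlgType")]
HB.structure Definition StarAlgebra (R : realType) :=
  {A of GRing.Lmodule R[i] A & Lmodule_isStarAlgebra R A}.

Notation "x ** y" := (amul x y) : ring_scope.

HB.mixin Record StarAlgebra_isUnital (R : realType) A of StarAlgebra R A := {
  aone : A;
  amul1a : left_id aone (@amul R A);
  amula1 : right_id aone (@amul R A)
}.

#[short(type="unitalStarAlgType")]
HB.structure Definition UnitalStarAlgebra (R : realType) :=
  {A of StarAlgebra R A & StarAlgebra_isUnital R A}.

HB.mixin Record isCStarAlgebra (R : realType) A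
    of StarAlgebra R A & CompleteNormedModule R[i] A := {
  cstar_normM : forall x y : A, `|x ** y| <= `|x| * `|y|;
  cstar_normE : forall x : A, `|star x ** x| = `|x| ^+ 2
}.

#[short(type="cstarAlgType")]
HB.structure Definition CStarAlgebra (R : realType) :=
  {A of StarAlgebra R A & CompleteNormedModule R[i] A & isCStarAlgebra R A}.

#[short(type="unitalCStarAlgType")]
HB.structure Definition UnitalCStarAlgebra (R : realType) :=
  {A of CStarAlgebra R A & StarAlgebra_isUnital R A}.

Section star_algebra_theory.
Context {R : realType}.

Section star.
Variable A : starAlgType R.
Implicit Types x y : A.

Lemma amulNl x y : (- x) ** y = - (x ** y).
Proof. by rewrite -scaleN1r amulZl scaleN1r. Qed.

Lemma amulNr x y : x ** (- y) = - (x ** y).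
Proof. by rewrite -scaleN1r amulZr scaleN1r. Qed.

Lemma starN x : star (- x) = - star x.
Proof. by rewrite -scaleN1r starZ rmorphN rmorph1 scaleN1r. Qed.

Lemma amulBl x y z : (x - y) ** z = x ** z - y ** z.
Proof. by rewrite amulDl amulNl. Qed.

Lemma amulBr x y z : z ** (x - y) = z ** x - z ** y.
Proof. by rewrite amulDr amulNr. Qed.

Lemma amul0l x : 0 ** x = 0.
Proof. by rewrite -(scale0r (0 : A)) amulZl !scale0r. Qed.

Lemma amul0r x : x ** 0 = 0.
Proof. by rewrite -(scale0r (0 : A)) amulZr !scale0r. Qed.

Lemma star0 : star (0 : A) = 0.
Proof. by rewrite -(scale0r (0 : A)) starZ rmorph0 !scale0r. Qed.

Lemma starB x y : star (x - y) = star x - star y.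
Proof. by rewrite starD starN. Qed.

End star.

Lemma star1 (A : unitalStarAlgType R) : star (aone : A) = aone.
Proof. by rewrite -[LHS]amul1a -{1}(starK (aone : A)) -starM amul1a starK. Qed.

End star_algebra_theory.


(* The library norm on a normed R[i]-module takes its values in R[i]. *)
Definition rnorm (R : realType) (V : normedModType R[i]) (x : V) : R := Re `|x|.

Section seminorms.
Context {R : realType}.

Record cstar_seminorm (A : starAlgType R) (p : A -> R) : Prop := {
  seminormD : forall x y, p (x + y) <= p x + p y;
  seminormZ : forall (l : R[i]) x, p (l *: x) = Re `|l| * p x;
  seminormM : forall x y, p (x ** y) <= p x * p y;
  seminormE : forall x, p (star x ** x) = p x ^+ 2
}.

Record cstar_norm (A : starAlgType R) (p : A -> R) : Prop := {
  cstar_norm_seminorm :> cstar_seminorm p;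
  cstar_norm_eq0 : forall x, p x = 0 -> x = 0
}.

Lemma normcRe (z : R[i]) : `|z| = (Re `|z|)%:C.
Proof. by rewrite RRe_real // normr_real. Qed.

Lemma Re_normM (y z : R[i]) : Re `|y * z| = Re `|y| * Re `|z|.
Proof. by apply: complexI; rewrite rmorphM /= -!normcRe normrM. Qed.

Lemma Re_norm_ge0 (z : R[i]) : 0 <= Re `|z|.
Proof. by rewrite -lecR -normcRe normr_ge0. Qed.

Lemma Re_norm_real (r : R) : Re `|r%:C| = `|r|.
Proof. by rewrite normc_def /= expr0n addr0 sqrtr_sqr. Qed.

Lemma Re_normJ (z : R[i]) : Re `|conjc z| = Re `|z|.
Proof. by rewrite normcJ. Qed.

Lemma normCE (V : normedModType R[i]) (x : V) : `|x| = (rnorm x)%:C.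
Proof. by rewrite RRe_real // normr_real. Qed.

Section rnorm.
Variable V : normedModType R[i].
Implicit Types x y : V.

Lemma rnorm_ge0 x : 0 <= rnorm x.
Proof. by rewrite -lecR -normCE normr_ge0. Qed.

Lemma rnormD x y : rnorm (x + y) <= rnorm x + rnorm y.
Proof. by rewrite -lecR rmorphD /= -!normCE ler_normD. Qed.

Lemma rnormZ (l : R[i]) x : rnorm (l *: x) = Re `|l| * rnorm x.
Proof. by apply: complexI; rewrite rmorphM /= -!normCE -normcRe normrZ. Qed.

Lemma rnormN x : rnorm (- x) = rnorm x.
Proof. by rewrite /rnorm normrN. Qed.

Lemma rnorm0 : rnorm (0 : V) = 0.
Proof. by rewrite /rnorm normr0. Qed.

Lemma rnorm_eq0 x : rnorm x = 0 -> x = 0.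
Proof. by move=> x0; apply/eqP; rewrite -normr_eq0 normCE x0. Qed.

End rnorm.

Lemma rnorm_cstar_norm (A : cstarAlgType R) : cstar_norm (@rnorm R A).
Proof.
split=> [|x]; last exact: rnorm_eq0.
split=> [x y|l x|x y|x]; [exact: rnormD|exact: rnormZ| |].
  by rewrite -lecR rmorphM /= -!normCE cstar_normM.
by apply: complexI; rewrite rmorphXn /= -!normCE cstar_normE.
Qed.

Section seminorm_theory.
Variables (A : starAlgType R) (p : A -> R) (hp : cstar_seminorm p).
Implicit Types x y : A.

Lemma seminorm0 : p 0 = 0.
Proof. by rewrite -(scale0r (0 : A)) (seminormZ hp) normr0 mul0r. Qed.

Lemma seminormN x : p (- x) = p x.
Proof.
by rewrite -scaleN1r (seminormZ hp) normrN normr1 /= mul1r.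
Qed.

Lemma seminormB x y : p (x - y) = p (y - x).
Proof. by rewrite -seminormN opprB. Qed.

Lemma seminorm_ge0 x : 0 <= p x.
Proof.
have := seminormD hp x (- x); rewrite subrr seminorm0 seminormN; lra.
Qed.

Lemma seminorm_star x : p (star x) = p x.
Proof.
have le y : p y <= p (star y).
  have := seminorm_ge0 y; rewrite le_eqVlt => /orP[/eqP <-|y0].
    exact: seminorm_ge0.
  by rewrite -(ler_pM2r y0) -expr2 -(seminormE hp) (seminormM hp).
by apply/eqP; rewrite eq_le le -{2}(starK x) le.
Qed.

Lemma seminorm_triangle x y z : p (x - z) <= p (x - y) + p (y - z).
Proof. by rewrite (le_trans _ (seminormD hp _ _)) // addrA subrK. Qed.

Lemma seminorm_dist x y : `|p x - p y| <= p (x - y).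
Proof.
have := seminormD hp (x - y) y; have := seminormD hp (y - x) x.
by rewrite !subrK ler_norml (seminormB y) => *; apply/andP; split; lra.
Qed.

End seminorm_theory.

Lemma seminorm1 (A : unitalStarAlgType R) (p : A -> R) :
  cstar_seminorm p -> p aone <= 1.
Proof.
move=> hp; have := seminormE hp aone; rewrite star1 amul1a => e.
have := seminorm_ge0 hp aone; nra.
Qed.

End seminorms.

Section contraction.
Context {R : realType}.

Lemma gt0_complex (e : R[i]) : 0 < e -> e = (Re e)%:C /\ 0 < Re e.
Proof.
move=> e0; have er : e = (Re e)%:C by rewrite RRe_real // gtr0_real.
by split=> //; rewrite -ltcR -er.
Qed.

Lemma rnorm_complete (V : completeNormedModType R[i]) (u : nat -> V) :
  (forall e : R, 0 < e -> exists N, forall m n, (N <= m)%N -> (N <= n)%N ->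
    rnorm (u m - u n) < e) ->
  exists l, forall e : R, 0 < e -> exists N, forall n, (N <= n)%N ->
    rnorm (u n - l) < e.
Proof.
move=> cu; have : cvg (u @ \oo).
  apply: cauchy_cvg; apply/cauchyP => e /gt0_complex[-> e0].
  have [N HN] := cu _ e0; exists (u N); exists N => // n /= Nn.
  by rewrite -ball_normE /= normCE ltcR HN.
move=> /cvg_ex[l /cvgrPdist_lt ul]; exists l => e e0.
have [|N _ HN] := ul e%:C; first by rewrite ltcR.
exists N => n Nn; have := HN n Nn.
by rewrite /= normCE ltcR -rnormN opprB.
Qed.

Lemma ler_addgt0_eq0 (r : R) : 0 <= r -> (forall e, 0 < e -> r <= e) -> r = 0.
Proof.
move=> r0 h; apply/eqP; rewrite eq_le r0 andbT.
by apply/ler_addgt0Pr => e e0; rewrite add0r h.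
Qed.

Section sqrt.
Variables (A : unitalCStarAlgType R) (a : A).
Hypotheses (sa : star a = a) (a1 : rnorm a < 1).
Let x := a ** a.
Let t := rnorm a ^+ 2.
Let h : R[i] := (2^-1 : R)%:C.

Let nA := cstar_norm_seminorm (@rnorm_cstar_norm R A).

Let hh : h + h = 1.
Proof. by rewrite /h -rmorphD /= -[RHS](rmorph1 (real_complex R)); congr (_%:C); lra. Qed.

Let nh : Re `|h| = 2^-1.
Proof. by rewrite Re_norm_real ger0_norm // invr_ge0. Qed.

Let t0 : 0 <= t. Proof. exact: sqr_ge0. Qed.
Let t1 : t < 1.
Proof. by rewrite /t expr_lt1 // rnorm_ge0. Qed.
Let xt : rnorm x = t.
Proof. by rewrite /x -{1}sa (seminormE nA). Qed.

Let F (y : A) := h *: (x + y ** y).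
Let y (n : nat) := iter n F 0.

Let F_le z : rnorm z <= t -> rnorm (F z) <= t.
Proof.
move=> zt; rewrite /F rnormZ nh.
have := rnormD x (z ** z); rewrite xt.
have := seminormM nA z z.
have : rnorm z * rnorm z <= t * 1.
  by apply: ler_pM; rewrite ?rnorm_ge0 // (le_trans zt) // ltW.
lra.
Qed.

Let F_lip z w : rnorm z <= t -> rnorm w <= t ->
  rnorm (F z - F w) <= t * rnorm (z - w).
Proof.
move=> zt wt; rewrite /F -scalerBr rnormZ nh.
have -> : x + z ** z - (x + w ** w) = z ** (z - w) + (z - w) ** w.
  by rewrite amulBr amulBl addrA subrK opprD addrACA subrr add0r.
have := rnormD (z ** (z - w)) ((z - w) ** w).
have := seminormM nA z (z - w); have := seminormM nA (z - w) w.
have : rnorm z * rnorm (z - w) <= t * rnorm (z - w).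
  by rewrite ler_wpM2r ?rnorm_ge0.
have : rnorm (z - w) * rnorm w <= t * rnorm (z - w).
  by rewrite mulrC ler_wpM2r ?rnorm_ge0.
lra.
Qed.

Let y_le n : rnorm (y n) <= t.
Proof. by elim: n => [|n ih]; rewrite /y /= ?rnorm0 // F_le. Qed.

Let y_dist n m : rnorm (y (n + m)%N - y n) <= t ^+ n.
Proof.
elim: n => [|n ih].
  by rewrite add0n subr0 expr0 (le_trans (y_le _)) // ltW.
rewrite addSn /y /= exprS (le_trans (F_lip _ _)) ?y_le //.
by rewrite ler_wpM2l.
Qed.

Let y_star n : star (y n) = y n.
Proof.
elim: n => [|n ih]; rewrite /y /= ?star0 // -/(y n).
by rewrite starZ starD !starM sa ih conjc_real.
Qed.

Let y_comm n : y n ** a = a ** y n.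
Proof.
elim: n => [|n ih]; rewrite /y /= ?amul0l ?amul0r // -/(y n).
rewrite amulZl amulZr amulDl amulDr !amulA; congr (_ *: (_ + _)).
by rewrite -amulA ih amulA ih.
Qed.

Lemma cstar_sqrt : exists c : A,
  [/\ star c = c, c ** a = a ** c & a ** a + c ** c = aone].
Proof.
have [l ll] : exists l, forall e : R, 0 < e -> exists N, forall n, (N <= n)%N ->
    rnorm (y n - l) < e.
  apply: rnorm_complete => e e0.
  have /cvgrPdist_lt/(_ (e / 2)) [|N _ HN] : (t ^+ n @[n --> \oo] --> (0 : R)).
  - by apply: cvg_expr; rewrite ger0_norm.
  - by rewrite divr_gt0.
  exists N => m n Nm Nn.
  have := HN N (leqnn N); rewrite /= sub0r normrN (ger0_norm (exprn_ge0 N t0)) => tN.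
  have := y_dist N (m - N); have := y_dist N (n - N).
  rewrite !subnKC // => nN mN.
  have := rnormD (y m - y N) (y N - y n).
  by rewrite addrA subrK -(rnormN (y N - y n)) opprB; lra.
have small (z : A) (C : R) : 0 <= C ->
    (forall n, rnorm z <= C * (rnorm (y n - l) + rnorm (y n.+1 - l))) -> z = 0.
  move=> C0 hz; apply: rnorm_eq0; apply: ler_addgt0_eq0 => [|e e0].
    exact: rnorm_ge0.
  have C1 : 0 < C + 1 by lra.
  have [|N HN] := ll (e / 2 / (C + 1)); first by rewrite !divr_gt0.
  apply: (le_trans (hz N)).
  have {HN} := conj (HN N (leqnn N)) (HN N.+1 (leqnSn N)).
  rewrite !ltr_pdivlMr // => -[].
  have := rnorm_ge0 (y N - l); have := rnorm_ge0 (y N.+1 - l).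
  move: (rnorm _) (rnorm _) => r1 r2; nra.
have l_le : rnorm l <= t.
  apply/ler_addgt0Pr => e /ll[N /(_ N (leqnn N)) HN].
  have := rnormD (y N) (l - y N); rewrite addrC subrK -(rnormN (l - y N)) opprB.
  by have := y_le N; lra.
have lE : l - F l = 0.
  apply: (small _ 1) => // n; rewrite mul1r.
  have -> : l - F l = (l - y n.+1) + (F (y n) - F l).
    by rewrite addrA subrK.
  apply: (le_trans (rnormD _ _)); rewrite addrC lerD //.
    apply: (le_trans (F_lip _ _)) => //.
    by rewrite ler_piMl ?rnorm_ge0 // ltW.
  by rewrite -rnormN opprB.
have l_star : star l - l = 0.
  apply: (small _ 2) => // n.
  have -> : star l - l = (y n - l) - star (y n - l).
    by rewrite starB y_star opprB [RHS]addrC addrA subrK.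
  apply: (le_trans (rnormD _ _)); rewrite rnormN (seminorm_star nA).
  have := rnorm_ge0 (y n.+1 - l); have := rnorm_ge0 (y n - l); lra.
have l_comm : l ** a - a ** l = 0.
  apply: (small _ (2 * rnorm a)) => [|n]; first by rewrite mulr_ge0 // rnorm_ge0.
  have -> : l ** a - a ** l = a ** (y n - l) - (y n - l) ** a.
    by rewrite amulBl amulBr y_comm opprB [RHS]addrC addrA subrK.
  apply: (le_trans (rnormD _ _)); rewrite rnormN.
  have := seminormM nA a (y n - l); have := seminormM nA (y n - l) a.
  have := rnorm_ge0 (y n.+1 - l); have := rnorm_ge0 (y n - l).
  have := rnorm_ge0 a.
  move: (rnorm (_ ** _)) (rnorm (_ ** _)) => r1 r2; nra.
have {}lE : l + l = x + l ** l.
  by move/subr0_eq: lE => {1 2}->; rewrite /F -scalerDl hh scale1r.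
exists (aone - l); split.
- by rewrite starB star1 (subr0_eq l_star).
- by rewrite amulBl amulBr amul1a amula1 (subr0_eq l_comm).
- rewrite amulBl amul1a amulBr amula1 -/x.
  by rewrite opprB addrACA -opprD lE opprD addrACA subrr addr0 addrCA subrr addr0.
Qed.

End sqrt.

(* Every self-adjoint a with |a| < 1 is the real part of a unitary a + i c. *)
Lemma seminorm_le_rnorm (A : unitalCStarAlgType R) (p : A -> R) (a : A) :
  cstar_seminorm p -> p a <= rnorm a.
Proof.
move=> hp.
have nA := cstar_norm_seminorm (rnorm_cstar_norm A).
have lt1 (b : A) : star b = b -> rnorm b < 1 -> p b <= 1.
  move=> sb b1; have [c [sc cb bc]] := cstar_sqrt sb b1.
  pose u := b + 'i *: c.
  have su : star u = b - 'i *: c.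
    rewrite /u starD starZ sb sc; congr (_ + _).
    by rewrite -scaleNr; congr (_ *: _); apply/eqP; rewrite eq_complex /= oppr0 !eqxx.
  have uu : star u ** u = aone.
    rewrite su /u amulDr !amulBl !amulZl !amulZr cb scalerA.
    have -> : 'i * 'i = -1 :> R[i] by rewrite -expr2 sqr_i.
    by rewrite scaleN1r opprK addrA subrK bc.
  have pu : p u <= 1.
    have := seminormE hp u; rewrite uu; have := seminorm1 hp.
    by have := seminorm_ge0 hp u; nra.
  have := seminormD hp u (star u); rewrite (seminorm_star hp).
  have -> : u + star u = (2 : R)%:C *: b.
    by rewrite su /u addrACA subrr addr0 rmorphD rmorph1 scalerDl !scale1r.
  rewrite (seminormZ hp) Re_norm_real ger0_norm //; lra.
have sa (b : A) : star b = b -> p b <= rnorm b.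
  move=> sb; apply/ler_addgt0Pr => e e0.
  have b0 := rnorm_ge0 b; have d0 : 0 < rnorm b + e by lra.
  have Ni : Re `|(((rnorm b + e)^-1 : R)%:C : R[i])| = (rnorm b + e)^-1.
    by rewrite Re_norm_real ger0_norm // invr_ge0 ltW.
  have := lt1 (((rnorm b + e)^-1 : R)%:C *: b).
  rewrite starZ conjc_real sb rnormZ (seminormZ hp) Ni.
  by rewrite !ler_pdivrMl // mulr1 ltr_pdivrMl // mulr1 ltrDl; apply.
rewrite -(@ler_pXn2r _ 2) ?nnegrE ?rnorm_ge0 ?(seminorm_ge0 hp) //.
by rewrite -(seminormE hp) -(seminormE nA) sa // starM starK.
Qed.

End contraction.

Section algebraic_tensor.
Context {R : realType}.

Record balanced (A B : lmodType R[i]) (V : zmodType) (f : A -> B -> V) : Prop := {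
  balancedDl : forall a a' b, f (a + a') b = f a b + f a' b;
  balancedDr : forall a b b', f a (b + b') = f a b + f a b';
  balancedZ : forall (l : R[i]) a b, f (l *: a) b = f a (l *: b)
}.

Definition tensor_sum (A B : lmodType R[i]) (V : zmodType) (f : A -> B -> V)
    (s : seq (A * B)) : V :=
  \sum_(z <- s) f z.1 z.2.

(* The sequence of the (a_k, b_k) stands for the sum of the a_k (x) b_k; two   *)
(* sums are equal in the tensor product over C when no balanced map into an   *)
(* abelian group separates them.                                              *)
Definition tensor_eq (A B : lmodType R[i]) (s t : seq (A * B)) : Prop :=
  forall (V : zmodType) (f : A -> B -> V), balanced f ->
    tensor_sum f s = tensor_sum f t.

Section carrier.
Variables A B : starAlgType R.

Let e (s t : seq (A * B)) : bool := `[< tensor_eq s t >].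

Let e_refl : reflexive e.
Proof. by move=> s; apply/asboolP. Qed.

Let e_sym : symmetric e.
Proof.
move=> s t; apply/idP/idP => /asboolP h; apply/asboolP => V f bf;
  by rewrite (h V f bf).
Qed.

Let e_trans : transitive e.
Proof.
move=> s t u /asboolP h /asboolP k; apply/asboolP => V f bf.
by rewrite (h V f bf) (k V f bf).
Qed.

Definition tensor_equiv := EquivRel e e_refl e_sym e_trans.

Definition atensor : Type := {eq_quot tensor_equiv}%qT.

HB.instance Definition _ := Choice.on atensor.
HB.instance Definition _ := EqQuotient.on atensor.

Definition tclass (s : seq (A * B)) : atensor := (\pi_atensor s)%qT.
Definition trepr (x : atensor) : seq (A * B) := repr x.

Definition teval (V : zmodType) (f : A -> B -> V) (x : atensor) : V :=
  tensor_sum f (trepr x).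

Lemma tevalE (V : zmodType) (f : A -> B -> V) s : balanced f ->
  teval f (tclass s) = tensor_sum f s.
Proof.
move=> bf; suff /asboolP/(_ V f bf) : tensor_equiv (trepr (tclass s)) s by [].
by apply/eqmodP; rewrite /trepr reprK.
Qed.

Lemma teval_inj (x y : atensor) :
  (forall (V : zmodType) (f : A -> B -> V), balanced f -> teval f x = teval f y) ->
  x = y.
Proof.
move=> h; rewrite -[x]reprK -[y]reprK; apply/eqmodP/asboolP => V f bf.
exact: h.
Qed.

Lemma tevalD (V : zmodType) (f g : A -> B -> V) x :
  teval (fun a b => f a b + g a b) x = teval f x + teval g x.
Proof. by rewrite /teval /tensor_sum big_split. Qed.

Lemma eq_teval (V : zmodType) (f g : A -> B -> V) x :
  (forall a b, f a b = g a b) -> teval f x = teval g x.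
Proof. by move=> fg; rewrite /teval /tensor_sum; apply: eq_bigr => z _. Qed.

Definition tadd (x y : atensor) := tclass (trepr x ++ trepr y).
Definition topp (x : atensor) := tclass [seq (- z.1, z.2) | z <- trepr x].
Definition tscale (l : R[i]) (x : atensor) :=
  tclass [seq (l *: z.1, z.2) | z <- trepr x].
Definition tmul (x y : atensor) :=
  tclass [seq (z.1 ** w.1, z.2 ** w.2) | z <- trepr x, w <- trepr y].
Definition tstar (x : atensor) := tclass [seq (star z.1, star z.2) | z <- trepr x].

Section teval_ops.
Variables (V : zmodType) (f : A -> B -> V) (bf : balanced f).

Lemma balanced0l b : f 0 b = 0.
Proof. by apply: (addrI (f 0 b)); rewrite -(balancedDl bf) !addr0. Qed.

Lemma balancedNl a b : f (- a) b = - f a b.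
Proof.
by apply: (addrI (f a b)); rewrite -(balancedDl bf) !subrr balanced0l.
Qed.

Lemma balanced_scale (l : R[i]) : balanced (fun a b => f (l *: a) b).
Proof.
split=> [a a' b|a b b'|m a b].
- by rewrite scalerDr (balancedDl bf).
- by rewrite (balancedDr bf).
- by rewrite scalerA mulrC -scalerA (balancedZ bf).
Qed.

Lemma balanced_star : balanced (fun a b => f (star a) (star b)).
Proof.
split=> [a a' b|a b b'|m a b].
- by rewrite starD (balancedDl bf).
- by rewrite starD (balancedDr bf).
- by rewrite !starZ (balancedZ bf).
Qed.

Lemma balanced_mul c d : balanced (fun a b => f (a ** c) (b ** d)).
Proof.
split=> [a a' b|a b b'|m a b].
- by rewrite amulDl (balancedDl bf).
- by rewrite amulDl (balancedDr bf).
- by rewrite !amulZl (balancedZ bf).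
Qed.

Lemma balanced_mulr a b : balanced (fun c d => f (a ** c) (b ** d)).
Proof.
split=> [c c' d|c d d'|m c d].
- by rewrite amulDr (balancedDl bf).
- by rewrite amulDr (balancedDr bf).
- by rewrite !amulZr (balancedZ bf).
Qed.

Lemma balanced_teval (y : atensor) :
  balanced (fun a b => teval (fun c d => f (a ** c) (b ** d)) y).
Proof.
split=> [a a' b|a b b'|m a b].
- by rewrite -tevalD; apply: eq_teval => c d; rewrite amulDl (balancedDl bf).
- by rewrite -tevalD; apply: eq_teval => c d; rewrite amulDl (balancedDr bf).
- by apply: eq_teval => c d; rewrite !amulZl (balancedZ bf).
Qed.

Lemma teval_add x y : teval f (tadd x y) = teval f x + teval f y.
Proof. by rewrite tevalE // /tensor_sum big_cat. Qed.

Lemma teval_opp x : teval f (topp x) = - teval f x.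
Proof.
rewrite tevalE // /tensor_sum big_map -sumrN.
by apply: eq_bigr => z _ /=; rewrite balancedNl.
Qed.

Lemma teval_zero : teval f (tclass [::]) = 0.
Proof. by rewrite tevalE // /tensor_sum big_nil. Qed.

Lemma teval_scale l x : teval f (tscale l x) = teval (fun a b => f (l *: a) b) x.
Proof. by rewrite tevalE // /tensor_sum big_map. Qed.

Lemma teval_star x : teval f (tstar x) = teval (fun a b => f (star a) (star b)) x.
Proof. by rewrite tevalE // /tensor_sum big_map. Qed.

Lemma teval_mul x y : teval f (tmul x y) =
  teval (fun a b => teval (fun c d => f (a ** c) (b ** d)) y) x.
Proof. by rewrite tevalE // /tensor_sum big_allpairs_dep. Qed.

Lemma teval_exchange (g : A -> B -> A -> B -> V) x y :
  teval (fun a b => teval (g a b) y) x =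
  teval (fun c d => teval (fun a b => g a b c d) x) y.
Proof. by rewrite /teval /tensor_sum exchange_big. Qed.

End teval_ops.

Let taddA : associative tadd.
Proof.
by move=> x y z; apply: teval_inj => V f bf; rewrite !teval_add // addrA.
Qed.

Let taddC : commutative tadd.
Proof. by move=> x y; apply: teval_inj => V f bf; rewrite !teval_add // addrC. Qed.

Let tadd0 : left_id (tclass [::]) tadd.
Proof.
by move=> x; apply: teval_inj => V f bf; rewrite teval_add // teval_zero // add0r.
Qed.

Let taddN : left_inverse (tclass [::]) topp tadd.
Proof.
move=> x; apply: teval_inj => V f bf.
by rewrite teval_add // teval_zero // teval_opp // addNr.
Qed.

HB.instance Definition _ :=
  GRing.isZmodule.Build atensor taddA taddC tadd0 taddN.

Lemma teval_linD (V : zmodType) (f : A -> B -> V) (x y : atensor) :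
  balanced f -> teval f (x + y) = teval f x + teval f y.
Proof. by move=> bf; exact: teval_add. Qed.

Let tscaleA a b v : tscale a (tscale b v) = tscale (a * b) v.
Proof.
apply: teval_inj => V f bf; rewrite !teval_scale //; last exact: balanced_scale.
by apply: eq_teval => c d; rewrite scalerA.
Qed.

Let tscale1 : left_id 1 tscale.
Proof.
move=> v; apply: teval_inj => V f bf; rewrite teval_scale //.
by apply: eq_teval => c d; rewrite scale1r.
Qed.

Let tscaleDr : right_distributive tscale +%R.
Proof.
move=> l x y; apply: teval_inj => V f bf.
by rewrite !(teval_linD, teval_scale) //; exact: balanced_scale.
Qed.

Let tscaleDl v : {morph tscale^~ v : a b / a + b}.
Proof.
move=> a b; apply: teval_inj => V f bf.
rewrite teval_linD // !teval_scale // -tevalD.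
by apply: eq_teval => c d; rewrite scalerDl (balancedDl bf).
Qed.

HB.instance Definition _ := GRing.Zmodule_isLmodule.Build R[i] atensor
  tscaleA tscale1 tscaleDr tscaleDl.

Let tmulA : associative tmul.
Proof.
move=> x y z; apply: teval_inj => V f bf; rewrite !teval_mul //; last first.
  exact: balanced_teval.
apply: eq_teval => a b; rewrite teval_mul; last exact: balanced_mulr.
by apply: eq_teval => c d; apply: eq_teval => g h; rewrite !amulA.
Qed.

Let tmulDl : left_distributive tmul +%R.
Proof.
move=> x y z; apply: teval_inj => V f bf.
by rewrite teval_linD // !teval_mul // teval_linD //; exact: balanced_teval.
Qed.

Let tmulDr : right_distributive tmul +%R.
Proof.
move=> x y z; apply: teval_inj => V f bf.
rewrite teval_linD // !teval_mul // -tevalD; apply: eq_teval => a b.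
by rewrite teval_linD //; exact: balanced_mulr.
Qed.

Let tmulZl (l : R[i]) (x y : atensor) : tmul (l *: x) y = l *: tmul x y.
Proof.
apply: teval_inj => V f bf; rewrite !teval_mul // !teval_scale //; last first.
  exact: balanced_teval.
rewrite teval_mul; last exact: balanced_scale.
by apply: eq_teval => a b; apply: eq_teval => c d; rewrite amulZl.
Qed.

Let tmulZr (l : R[i]) (x y : atensor) : tmul x (l *: y) = l *: tmul x y.
Proof.
apply: teval_inj => V f bf; rewrite !teval_mul // teval_scale //.
rewrite teval_mul; last exact: balanced_scale.
apply: eq_teval => a b; rewrite teval_scale; last exact: balanced_mulr.
by apply: eq_teval => c d; rewrite amulZr.
Qed.

Let tstarK : involutive tstar.
Proof.
move=> x; apply: teval_inj => V f bf; rewrite !teval_star //.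
  by apply: eq_teval => a b; rewrite !starK.
exact: balanced_star.
Qed.

Let tstarD : {morph tstar : x y / x + y}.
Proof.
move=> x y; apply: teval_inj => V f bf.
by rewrite teval_linD // !teval_star // teval_linD //; exact: balanced_star.
Qed.

Let tstarZ (l : R[i]) (x : atensor) : tstar (l *: x) = conjc l *: tstar x.
Proof.
apply: teval_inj => V f bf; rewrite teval_star // !teval_scale //.
  rewrite teval_star; last exact: balanced_scale.
  by apply: eq_teval => a b; rewrite starZ.
exact: balanced_star.
Qed.

Let tstarM (x y : atensor) : tstar (tmul x y) = tmul (tstar y) (tstar x).
Proof.
apply: teval_inj => V f bf; rewrite teval_star // !teval_mul //; last first.
  exact: balanced_star.
rewrite teval_star; last exact: balanced_teval.
rewrite teval_exchange; apply: eq_teval => a b.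
rewrite teval_star; last exact: balanced_mulr.
by apply: eq_teval => c d; rewrite !starM.
Qed.

HB.instance Definition _ := Lmodule_isStarAlgebra.Build R atensor
  tmulA tmulDl tmulDr tmulZl tmulZr tstarK tstarD tstarZ tstarM.

Definition simple_tensor (a : A) (b : B) : atensor := tclass [:: (a, b)].

Lemma teval_simple (V : zmodType) (f : A -> B -> V) a b :
  balanced f -> teval f (simple_tensor a b) = f a b.
Proof. by move=> bf; rewrite tevalE // /tensor_sum big_seq1. Qed.

Lemma atensor_sum (x : atensor) :
  x = \sum_(z <- trepr x) simple_tensor z.1 z.2.
Proof.
apply: teval_inj => V f bf.
rewrite {1}/teval /tensor_sum.
elim: (trepr x) => [|z s ih]; first by rewrite !big_nil [RHS]teval_zero.
by rewrite !big_cons teval_linD // teval_simple // ih.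
Qed.

Lemma simple_tensorDl a a' b :
  simple_tensor (a + a') b = simple_tensor a b + simple_tensor a' b.
Proof.
apply: teval_inj => V f bf.
by rewrite teval_linD // !teval_simple // (balancedDl bf).
Qed.

Lemma simple_tensorDr a b b' :
  simple_tensor a (b + b') = simple_tensor a b + simple_tensor a b'.
Proof.
apply: teval_inj => V f bf.
by rewrite teval_linD // !teval_simple // (balancedDr bf).
Qed.

Lemma simple_tensorZl (l : R[i]) a b :
  simple_tensor (l *: a) b = l *: simple_tensor a b.
Proof.
apply: teval_inj => V f bf.
rewrite [RHS]teval_scale // !teval_simple //; exact: balanced_scale.
Qed.

Lemma simple_tensorZr (l : R[i]) a b :
  simple_tensor a (l *: b) = l *: simple_tensor a b.
Proof.
rewrite -simple_tensorZl; apply: teval_inj => V f bf.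
by rewrite !teval_simple // (balancedZ bf).
Qed.

Lemma simple_tensorM a b a' b' :
  simple_tensor a b ** simple_tensor a' b' = simple_tensor (a ** a') (b ** b').
Proof.
apply: teval_inj => V f bf; rewrite [LHS]teval_mul // !teval_simple //.
  exact: balanced_mulr.
exact: balanced_teval.
Qed.

Lemma simple_tensor_star a b :
  star (simple_tensor a b) = simple_tensor (star a) (star b).
Proof.
apply: teval_inj => V f bf; rewrite [LHS]teval_star // !teval_simple //.
exact: balanced_star.
Qed.

End carrier.

Section unital.
Variables A B : unitalStarAlgType R.

Let tone : atensor A B := simple_tensor aone aone.

Let tmul1 : left_id tone (@amul R (atensor A B)).
Proof.
move=> x; apply: teval_inj => V f bf; rewrite [LHS]teval_mul // teval_simple.
  by apply: eq_teval => a b; rewrite !amul1a.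
exact: balanced_teval.
Qed.

Let tmulr1 : right_id tone (@amul R (atensor A B)).
Proof.
move=> x; apply: teval_inj => V f bf; rewrite [LHS]teval_mul //.
apply: eq_teval => a b; rewrite teval_simple ?amula1 //; exact: balanced_mulr.
Qed.

HB.instance Definition _ := StarAlgebra_isUnital.Build R (atensor A B) tmul1 tmulr1.

End unital.
End algebraic_tensor.

Definition nuclear (R : realType) (A : cstarAlgType R) : Prop :=
  forall B : cstarAlgType R, exists p : atensor A B -> R,
    cstar_norm p /\ forall q : atensor A B -> R, cstar_norm q -> q = p.

Section star_morphisms.
Context {R : realType}.

Record star_hom (A B : starAlgType R) (f : A -> B) : Prop := {
  star_hom_linear : linear f;
  star_homM : forall x y, f (x ** y) = f x ** f y;
  star_hom_star : forall x, f (star x) = star (f x)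
}.

Record unital_star_hom (A B : unitalStarAlgType R) (f : A -> B) : Prop := {
  unital_star_hom_star_hom :> star_hom f;
  unital_star_hom1 : f aone = aone
}.

Lemma star_homD (A B : starAlgType R) (f : A -> B) : star_hom f ->
  forall x y, f (x + y) = f x + f y.
Proof. by move=> hf x y; rewrite -[x]scale1r (star_hom_linear hf) !scale1r. Qed.

Lemma star_hom0 (A B : starAlgType R) (f : A -> B) : star_hom f -> f 0 = 0.
Proof.
by move=> hf; apply: (addrI (f 0)); rewrite -(star_homD hf) !addr0.
Qed.

Lemma star_homZ (A B : starAlgType R) (f : A -> B) : star_hom f ->
  forall (l : R[i]) x, f (l *: x) = l *: f x.
Proof.
move=> hf l x; rewrite -[l *: x]addr0 (star_hom_linear hf).
by rewrite (star_hom0 hf) addr0.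
Qed.

Lemma seminorm_comp (A B : starAlgType R) (f : A -> B) (p : B -> R) :
  star_hom f -> cstar_seminorm p -> cstar_seminorm (p \o f).
Proof.
move=> hf hp; split=> [x y|l x|x y|x] /=.
- by rewrite (star_homD hf) (seminormD hp).
- by rewrite (star_homZ hf) (seminormZ hp).
- by rewrite (star_homM hf) (seminormM hp).
- by rewrite (star_homM hf) (star_hom_star hf) (seminormE hp).
Qed.

Lemma star_hom_contractive (A B : unitalCStarAlgType R) (f : A -> B) x :
  star_hom f -> rnorm (f x) <= rnorm x.
Proof.
move=> hf; apply: (seminorm_le_rnorm _ (p := @rnorm R B \o f)).
exact: seminorm_comp hf (rnorm_cstar_norm B).
Qed.

End star_morphisms.

Section maximal_seminorm.
Context {R : realType}.
Variables A B : unitalCStarAlgType R.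

(* The supremum is finite: each C*-seminorm is at most rnorm a * rnorm b on   *)
(* the simple tensor of a and b.                                              *)
Definition max_seminorm (x : atensor A B) : R :=
  sup [set p x | p in [set p : atensor A B -> R | cstar_seminorm p]].

Let left_hom : star_hom (fun a : A => simple_tensor a (aone : B)).
Proof.
split=> [l x y|x y|x].
- by rewrite simple_tensorDl simple_tensorZl.
- by rewrite simple_tensorM amul1a.
- by rewrite simple_tensor_star star1.
Qed.

Let right_hom : star_hom (fun b : B => simple_tensor (aone : A) b).
Proof.
split=> [l x y|x y|x].
- by rewrite simple_tensorDr simple_tensorZr.
- by rewrite simple_tensorM amul1a.
- by rewrite simple_tensor_star star1.
Qed.

Lemma seminorm_simple_tensor (p : atensor A B -> R) a b :
  cstar_seminorm p -> p (simple_tensor a b) <= rnorm a * rnorm b.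
Proof.
move=> hp.
have -> : simple_tensor a b = simple_tensor a aone ** simple_tensor aone b.
  by rewrite simple_tensorM amul1a amula1.
apply: (le_trans (seminormM hp _ _)); apply: ler_pM.
- exact: seminorm_ge0 hp _.
- exact: seminorm_ge0 hp _.
- exact: seminorm_le_rnorm _ (seminorm_comp left_hom hp).
- exact: seminorm_le_rnorm _ (seminorm_comp right_hom hp).
Qed.

Lemma seminorm_bound (p : atensor A B -> R) x : cstar_seminorm p ->
  p x <= \sum_(z <- trepr x) rnorm z.1 * rnorm z.2.
Proof.
move=> hp; rewrite {1}(atensor_sum x).
elim: (trepr x) => [|z s ih]; first by rewrite !big_nil (seminorm0 hp).
rewrite !big_cons (le_trans (seminormD hp _ _)) // lerD //.
exact: seminorm_simple_tensor.
Qed.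

Lemma seminorm_le_max (p : atensor A B -> R) x :
  cstar_seminorm p -> p x <= max_seminorm x.
Proof.
move=> hp; apply: ub_le_sup; last by exists p.
exists (\sum_(z <- trepr x) rnorm z.1 * rnorm z.2) => _ [q hq <-].
exact: seminorm_bound.
Qed.

Lemma max_seminorm_le x (r : R) :
  (forall p : atensor A B -> R, cstar_seminorm p -> p x <= r) ->
  max_seminorm x <= r.
Proof.
move=> h; apply: ge_sup; last by move=> _ [p hp <-]; exact: h.
exists 0, (fun=> 0) => //; split=> *; rewrite ?addr0 ?mulr0 //.
by rewrite expr0n.
Qed.

Lemma max_seminorm_ge0 x : 0 <= max_seminorm x.
Proof.
apply: (@seminorm_le_max (fun=> 0)); split=> *; rewrite ?addr0 ?mulr0 //.
by rewrite expr0n.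
Qed.

Lemma max_cstar_seminorm : cstar_seminorm max_seminorm.
Proof.
split=> [x y|l x|x y|x].
- apply: max_seminorm_le => p hp; apply: (le_trans (seminormD hp _ _)).
  by rewrite lerD // seminorm_le_max.
- have l0 := Re_norm_ge0 l; apply/eqP; rewrite eq_le; apply/andP; split.
    apply: max_seminorm_le => p hp; rewrite (seminormZ hp).
    by rewrite ler_wpM2l // seminorm_le_max.
  have [->|l1] := eqVneq (Re `|l|) 0; first by rewrite mul0r max_seminorm_ge0.
  have {l1}l0 : 0 < Re `|l| by rewrite lt_neqAle eq_sym l1.
  rewrite -ler_pdivlMl //; apply: max_seminorm_le => p hp.
  by rewrite ler_pdivlMl // -(seminormZ hp) seminorm_le_max.
- apply: max_seminorm_le => p hp; apply: (le_trans (seminormM hp _ _)).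
  by rewrite ler_pM ?(seminorm_ge0 hp) // seminorm_le_max.
- apply/eqP; rewrite eq_le; apply/andP; split.
    apply: max_seminorm_le => p hp; rewrite (seminormE hp).
    by rewrite lerXn2r ?nnegrE ?(seminorm_ge0 hp) ?max_seminorm_ge0 // seminorm_le_max.
  rewrite -[leRHS]sqr_sqrtr ?max_seminorm_ge0 //.
  rewrite lerXn2r ?nnegrE ?sqrtr_ge0 ?max_seminorm_ge0 //.
  apply: max_seminorm_le => p hp; rewrite -[leLHS]ger0_norm ?(seminorm_ge0 hp) //.
  by rewrite -sqrtr_sqr ler_wsqrtr // -(seminormE hp) seminorm_le_max.
Qed.

End maximal_seminorm.

Section subproduct.
Context {R : realType}.
Variable A : nat -> unitalStarAlgType R.
Implicit Types u v : forall n, A n.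

Record subproduct_closed (D : (forall n, A n) -> Prop) : Prop := {
  subproductD : forall u v, D u -> D v -> D (fun n => u n + v n);
  subproductZ : forall (l : R[i]) u, D u -> D (fun n => l *: u n);
  subproductM : forall u v, D u -> D v -> D (fun n => u n ** v n);
  subproduct_star : forall u, D u -> D (fun n => star (u n));
  subproduct1 : D (fun n => aone)
}.

Variables (D : (forall n, A n) -> Prop) (hD : subproduct_closed D).

Definition subproduct of subproduct_closed D := {u : forall n, A n | D u}.

Local Notation S := (subproduct hD).

HB.instance Definition _ := gen_eqMixin S.
HB.instance Definition _ := gen_choiceMixin S.

Definition terms (u : S) : forall n, A n := sval u.

Lemma termsP (u : S) : D (terms u). Proof. exact: svalP. Qed.

Lemma terms_inj (u v : S) : (forall n, terms u n = terms v n) -> u = v.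
Proof.
case: u v => [u hu] [v hv] uv; apply: eq_exist.
by apply: functional_extensionality_dep => n; exact: uv.
Qed.

Let D0 : D (fun n => 0).
Proof.
have := subproductZ hD 0 (subproduct1 hD).
by congr D; apply: functional_extensionality_dep => n; rewrite scale0r.
Qed.

Let DN u : D u -> D (fun n => - u n).
Proof.
move/(subproductZ hD (-1)).
by congr D; apply: functional_extensionality_dep => n; rewrite scaleN1r.
Qed.

Let sadd (u v : S) : S := exist D _ (subproductD hD (termsP u) (termsP v)).
Let szero : S := exist D _ D0.
Let sopp (u : S) : S := exist D _ (DN (termsP u)).
Let sscale (l : R[i]) (u : S) : S := exist D _ (subproductZ hD l (termsP u)).
Let smul (u v : S) : S := exist D _ (subproductM hD (termsP u) (termsP v)).
Let sstar (u : S) : S := exist D _ (subproduct_star hD (termsP u)).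
Let sone : S := exist D _ (subproduct1 hD).

Let saddA : associative sadd.
Proof. by move=> u v w; apply: terms_inj => n; exact: addrA. Qed.
Let saddC : commutative sadd.
Proof. by move=> u v; apply: terms_inj => n; exact: addrC. Qed.
Let sadd0 : left_id szero sadd.
Proof. by move=> u; apply: terms_inj => n; exact: add0r. Qed.
Let saddN : left_inverse szero sopp sadd.
Proof. by move=> u; apply: terms_inj => n; exact: addNr. Qed.

HB.instance Definition _ := GRing.isZmodule.Build S saddA saddC sadd0 saddN.

Let sscaleA a b (v : S) : sscale a (sscale b v) = sscale (a * b) v.
Proof. by apply: terms_inj => n; exact: scalerA. Qed.
Let sscale1 : left_id 1 sscale.
Proof. by move=> u; apply: terms_inj => n; exact: scale1r. Qed.
Let sscaleDr : right_distributive sscale +%R.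
Proof. by move=> l u v; apply: terms_inj => n; exact: scalerDr. Qed.
Let sscaleDl (v : S) : {morph sscale^~ v : a b / a + b}.
Proof. by move=> a b; apply: terms_inj => n; exact: scalerDl. Qed.

HB.instance Definition _ := GRing.Zmodule_isLmodule.Build R[i] S
  sscaleA sscale1 sscaleDr sscaleDl.

Let smulA : associative smul.
Proof. by move=> u v w; apply: terms_inj => n; exact: amulA. Qed.
Let smulDl : left_distributive smul +%R.
Proof. by move=> u v w; apply: terms_inj => n; exact: amulDl. Qed.
Let smulDr : right_distributive smul +%R.
Proof. by move=> u v w; apply: terms_inj => n; exact: amulDr. Qed.
Let smulZl (l : R[i]) (u v : S) : smul (l *: u) v = l *: smul u v.
Proof. by apply: terms_inj => n; exact: amulZl. Qed.
Let smulZr (l : R[i]) (u v : S) : smul u (l *: v) = l *: smul u v.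
Proof. by apply: terms_inj => n; exact: amulZr. Qed.
Let sstarK : involutive sstar.
Proof. by move=> u; apply: terms_inj => n; exact: starK. Qed.
Let sstarD : {morph sstar : u v / u + v}.
Proof. by move=> u v; apply: terms_inj => n; exact: starD. Qed.
Let sstarZ (l : R[i]) (u : S) : sstar (l *: u) = conjc l *: sstar u.
Proof. by apply: terms_inj => n; exact: starZ. Qed.
Let sstarM (u v : S) : sstar (smul u v) = smul (sstar v) (sstar u).
Proof. by apply: terms_inj => n; exact: starM. Qed.

HB.instance Definition _ := Lmodule_isStarAlgebra.Build R S
  smulA smulDl smulDr smulZl smulZr sstarK sstarD sstarZ sstarM.

Let smul1 : left_id sone (@amul R S).
Proof. by move=> u; apply: terms_inj => n; exact: amul1a. Qed.
Let smulr1 : right_id sone (@amul R S).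
Proof. by move=> u; apply: terms_inj => n; exact: amula1. Qed.

HB.instance Definition _ := StarAlgebra_isUnital.Build R S smul1 smulr1.

Lemma termsB (u v : S) n : terms (u - v) n = terms u n - terms v n.
Proof. by []. Qed.

Section limit_seminorm.
Variable p : forall n, A n -> R.
Hypothesis hp : forall n, cstar_seminorm (@p n).
Hypothesis cvgp : forall u, D u -> cvgn (fun n => @p n (u n)).

Definition limit_seminorm (u : S) : R := limn (fun n => @p n (terms u n)).

Let cvgS (u : S) : @p n (terms u n) @[n --> \oo] --> limit_seminorm u.
Proof. exact: cvgp (termsP u). Qed.

Lemma limit_cstar_seminorm : cstar_seminorm limit_seminorm.
Proof.
split=> [u v|l u|u v|u].
- apply: (ler_cvg_to (@cvgS (u + v)) (cvgD (@cvgS u) (@cvgS v))).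
  by apply: nearW => n; exact: (seminormD (hp n)).
- apply: cvg_lim => //; under eq_fun do rewrite (seminormZ (hp _)).
  exact: cvgMl_tmp (@cvgS u).
- apply: (ler_cvg_to (@cvgS (u ** v)) (cvgM (@cvgS u) (@cvgS v))).
  by apply: nearW => n; exact: (seminormM (hp n)).
- apply: cvg_lim => //; under eq_fun do rewrite (seminormE (hp _)) expr2.
  exact: cvgM (@cvgS u) (@cvgS u).
Qed.

End limit_seminorm.
End subproduct.

Section separation.
Context {R : realType}.
Variables (P : unitalStarAlgType R) (p : P -> R) (hp : cstar_seminorm p).

Let e (x y : P) : bool := p (x - y) == 0.

Let le0 x : p x <= 0 -> p x = 0.
Proof. by move=> x0; apply/eqP; rewrite eq_le x0 (seminorm_ge0 hp). Qed.

Let e_refl : reflexive e.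
Proof. by move=> x; rewrite /e subrr (seminorm0 hp). Qed.

Let e_sym : symmetric e.
Proof. by move=> x y; rewrite /e (seminormB hp). Qed.

Let e_trans : transitive e.
Proof.
move=> y x z /eqP xy /eqP yz; apply/eqP/le0.
by rewrite (le_trans (seminorm_triangle hp _ y _)) // xy yz addr0.
Qed.

Definition null_equiv := EquivRel e e_refl e_sym e_trans.

Definition separated : Type := {eq_quot null_equiv}%qT.

Local Notation Q := separated.

HB.instance Definition _ := Choice.on Q.
HB.instance Definition _ := EqQuotient.on Q.

Definition sep_class (x : P) : Q := (\pi_Q x)%qT.
Let r (x : Q) : P := repr x.

Lemma sep_classP (x : Q) : exists y, x = sep_class y.
Proof. by exists (r x); rewrite /sep_class reprK. Qed.

Lemma sep_class_eq x y : p (x - y) = 0 -> sep_class x = sep_class y.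
Proof. by move=> xy; apply/eqmodP; apply/eqP. Qed.

Let rE x : p (r (sep_class x) - x) = 0.
Proof.
have /eqP -> // : null_equiv (r (sep_class x)) x.
by apply/eqmodP; rewrite /r reprK.
Qed.

Let qadd (x y : Q) : Q := sep_class (r x + r y).
Let qopp (x : Q) : Q := sep_class (- r x).
Let qscale (l : R[i]) (x : Q) : Q := sep_class (l *: r x).
Let qmul (x y : Q) : Q := sep_class (r x ** r y).
Let qstar (x : Q) : Q := sep_class (star (r x)).

Let qaddE x y : qadd (sep_class x) (sep_class y) = sep_class (x + y).
Proof.
apply/sep_class_eq/le0; rewrite opprD addrACA.
by rewrite (le_trans (seminormD hp _ _)) // !rE addr0.
Qed.

Let qoppE x : qopp (sep_class x) = sep_class (- x).
Proof. by apply/sep_class_eq; rewrite -opprD (seminormN hp) rE. Qed.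

Let qscaleE l x : qscale l (sep_class x) = sep_class (l *: x).
Proof. by apply/sep_class_eq; rewrite -scalerBr (seminormZ hp) rE mulr0. Qed.

Let qmulE x y : qmul (sep_class x) (sep_class y) = sep_class (x ** y).
Proof.
apply/sep_class_eq/le0.
set x' := r (sep_class x); set y' := r (sep_class y).
have -> : x' ** y' - x ** y = x' ** (y' - y) + (x' - x) ** y.
  by rewrite amulBl amulBr addrA subrK.
rewrite (le_trans (seminormD hp _ _)) // -[leRHS]addr0 lerD //.
  by rewrite (le_trans (seminormM hp _ _)) // rE mulr0.
by rewrite (le_trans (seminormM hp _ _)) // rE mul0r.
Qed.

Let qstarE x : qstar (sep_class x) = sep_class (star x).
Proof. by apply/sep_class_eq; rewrite -starB (seminorm_star hp) rE. Qed.

Let qaddA : associative qadd.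
Proof.
move=> x y z; have [[x' ->] [y' ->] [z' ->]] := And3 (sep_classP x) (sep_classP y) (sep_classP z).
by rewrite !qaddE addrA.
Qed.

Let qaddC : commutative qadd.
Proof.
by move=> x y; have [[x' ->] [y' ->]] := conj (sep_classP x) (sep_classP y);
  rewrite !qaddE addrC.
Qed.

Let qadd0 : left_id (sep_class 0) qadd.
Proof. by move=> x; have [x' ->] := sep_classP x; rewrite qaddE add0r. Qed.

Let qaddN : left_inverse (sep_class 0) qopp qadd.
Proof. by move=> x; have [x' ->] := sep_classP x; rewrite qoppE qaddE addNr. Qed.

HB.instance Definition _ := GRing.isZmodule.Build Q qaddA qaddC qadd0 qaddN.

Lemma sep_classD x y : sep_class (x + y) = sep_class x + sep_class y.
Proof. by rewrite -qaddE. Qed.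

Let qscaleA a b x : qscale a (qscale b x) = qscale (a * b) x.
Proof. by have [x' ->] := sep_classP x; rewrite !qscaleE scalerA. Qed.

Let qscale1 : left_id 1 qscale.
Proof. by move=> x; have [x' ->] := sep_classP x; rewrite qscaleE scale1r. Qed.

Let qscaleDr : right_distributive qscale +%R.
Proof.
by move=> l x y; have [[x' ->] [y' ->]] := conj (sep_classP x) (sep_classP y);
  rewrite -sep_classD !qscaleE -sep_classD scalerDr.
Qed.

Let qscaleDl x : {morph qscale^~ x : a b / a + b}.
Proof.
by move=> a b /=; have [x' ->] := sep_classP x;
  rewrite !qscaleE -sep_classD scalerDl.
Qed.

HB.instance Definition _ := GRing.Zmodule_isLmodule.Build R[i] Q
  qscaleA qscale1 qscaleDr qscaleDl.

Lemma sep_classZ (l : R[i]) x : sep_class (l *: x) = l *: sep_class x.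
Proof. by rewrite -qscaleE. Qed.

Let qmulA : associative qmul.
Proof.
move=> x y z; have [[x' ->] [y' ->] [z' ->]] := And3 (sep_classP x) (sep_classP y) (sep_classP z).
by rewrite !qmulE amulA.
Qed.

Let qmulDl : left_distributive qmul +%R.
Proof.
move=> x y z; have [[x' ->] [y' ->] [z' ->]] := And3 (sep_classP x) (sep_classP y) (sep_classP z).
by rewrite -sep_classD !qmulE -sep_classD amulDl.
Qed.

Let qmulDr : right_distributive qmul +%R.
Proof.
move=> x y z; have [[x' ->] [y' ->] [z' ->]] := And3 (sep_classP x) (sep_classP y) (sep_classP z).
by rewrite -sep_classD !qmulE -sep_classD amulDr.
Qed.

Let qmulZl (l : R[i]) (x y : Q) : qmul (l *: x) y = l *: qmul x y.
Proof.
have [[x' ->] [y' ->]] := conj (sep_classP x) (sep_classP y).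
by rewrite -sep_classZ !qmulE -sep_classZ amulZl.
Qed.

Let qmulZr (l : R[i]) (x y : Q) : qmul x (l *: y) = l *: qmul x y.
Proof.
have [[x' ->] [y' ->]] := conj (sep_classP x) (sep_classP y).
by rewrite -sep_classZ !qmulE -sep_classZ amulZr.
Qed.

Let qstarK : involutive qstar.
Proof. by move=> x; have [x' ->] := sep_classP x; rewrite !qstarE starK. Qed.

Let qstarD : {morph qstar : x y / x + y}.
Proof.
move=> x y; have [[x' ->] [y' ->]] := conj (sep_classP x) (sep_classP y).
by rewrite -sep_classD !qstarE -sep_classD starD.
Qed.

Let qstarZ (l : R[i]) (x : Q) : qstar (l *: x) = conjc l *: qstar x.
Proof.
by have [x' ->] := sep_classP x; rewrite -sep_classZ !qstarE -sep_classZ starZ.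
Qed.

Let qstarM (x y : Q) : qstar (qmul x y) = qmul (qstar y) (qstar x).
Proof.
have [[x' ->] [y' ->]] := conj (sep_classP x) (sep_classP y).
by rewrite !(qmulE, qstarE) starM.
Qed.

HB.instance Definition _ := Lmodule_isStarAlgebra.Build R Q
  qmulA qmulDl qmulDr qmulZl qmulZr qstarK qstarD qstarZ qstarM.

Lemma sep_classM x y : sep_class (x ** y) = sep_class x ** sep_class y.
Proof. by rewrite -qmulE. Qed.

Lemma sep_class_star x : sep_class (star x) = star (sep_class x).
Proof. by rewrite -qstarE. Qed.

Let qmul1 : left_id (sep_class aone) (@amul R Q).
Proof. by move=> x; have [x' ->] := sep_classP x; rewrite -sep_classM amul1a. Qed.

Let qmulr1 : right_id (sep_class aone) (@amul R Q).
Proof. by move=> x; have [x' ->] := sep_classP x; rewrite -sep_classM amula1. Qed.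

HB.instance Definition _ := StarAlgebra_isUnital.Build R Q qmul1 qmulr1.

Definition sep_norm (x : Q) : R[i] := (p (r x))%:C.

Lemma sep_normE x : sep_norm (sep_class x) = (p x)%:C.
Proof.
congr (_%:C); apply/eqP; rewrite -subr_eq0 -normr_le0.
by rewrite (le_trans (seminorm_dist hp _ _)) // rE.
Qed.

Let qnormD (x y : Q) : sep_norm (x + y) <= sep_norm x + sep_norm y.
Proof.
have [[x' ->] [y' ->]] := conj (sep_classP x) (sep_classP y).
by rewrite -sep_classD !sep_normE -rmorphD /= lecR (seminormD hp).
Qed.

Let qnormZ (l : R[i]) (x : Q) : sep_norm (l *: x) = `|l| * sep_norm x.
Proof.
have [x' ->] := sep_classP x.
by rewrite -sep_classZ !sep_normE (seminormZ hp) rmorphM /= -normcRe.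
Qed.

Let qnorm_eq0 (x : Q) : sep_norm x = 0 -> x = 0.
Proof.
have [x' ->] := sep_classP x; rewrite sep_normE => -[x0].
by apply: sep_class_eq; rewrite subr0.
Qed.

HB.instance Definition _ := Lmodule_isNormed.Build R[i] Q qnormD qnormZ qnorm_eq0.

Lemma sep_class_norm x : `|sep_class x| = (p x)%:C.
Proof. exact: sep_normE. Qed.

Lemma separated_normM (x y : Q) : `|x ** y| <= `|x| * `|y|.
Proof.
have [[x' ->] [y' ->]] := conj (sep_classP x) (sep_classP y).
by rewrite -sep_classM !sep_class_norm -rmorphM /= lecR (seminormM hp).
Qed.

Lemma separated_normE (x : Q) : `|star x ** x| = `|x| ^+ 2.
Proof.
have [x' ->] := sep_classP x.
by rewrite -sep_class_star -sep_classM !sep_class_norm (seminormE hp) rmorphXn.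
Qed.

End separation.

Section completion.
Context {R : realType}.
Variables (P : unitalStarAlgType R) (p : P -> R) (hp : cstar_seminorm p).

Definition seminorm_cauchy (u : nat -> P) : Prop :=
  forall eps : R, 0 < eps -> exists N, forall m n, (N <= m)%N -> (N <= n)%N ->
    p (u m - u n) < eps.

Lemma seminorm_cauchy_cvg u : seminorm_cauchy u -> cvgn (fun n => p (u n)).
Proof.
move=> cu; apply: cauchy_cvg; apply/cauchyP => e e0.
have [N HN] := cu _ e0; exists (p (u N)); exists N => // n /= Nn.
by rewrite -ball_normE /= (le_lt_trans (seminorm_dist hp _ _)) // HN.
Qed.

Lemma seminorm_cauchy_bound u : seminorm_cauchy u ->
  exists2 M : R, 0 < M & forall n, p (u n) <= M.
Proof.
move=> /(_ 1 ltr01)[N HN].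
exists (1 + \sum_(k < N.+1) p (u k)).
  rewrite ltr_pwDl // sumr_ge0 // => k _; exact: seminorm_ge0 hp _.
move=> n; have le k : (k <= N)%N -> p (u k) <= \sum_(k < N.+1) p (u k).
  move=> kN; rewrite (bigD1 (Ordinal (kN : (k < N.+1)%N))) //= lerDl.
  by rewrite sumr_ge0 // => j _; exact: seminorm_ge0 hp _.
have [nN|Nn] := leqP n N; first by have := le _ nN; lra.
have := seminormD hp (u n - u N) (u N); rewrite subrK.
by have := le _ (leqnn N); have := HN n N (ltnW Nn) (leqnn N); lra.
Qed.

Lemma cauchy_closed : @subproduct_closed R (fun=> P) seminorm_cauchy.
Proof.
split=> [u v cu cv|l u cu|u v cu cv|u cu|].
- move=> e e0; have e2 : 0 < e / 2 by rewrite divr_gt0.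
  have [[N HN] [M HM]] := conj (cu _ e2) (cv _ e2).
  exists (maxn N M) => m n; rewrite !geq_max => /andP[Nm Mm] /andP[Nn Mn].
  rewrite opprD addrACA (le_lt_trans (seminormD hp _ _)) //.
  by have := HN m n Nm Nn; have := HM m n Mm Mn; lra.
- move=> e e0; have l1 : 0 < Re `|l| + 1 by have := Re_norm_ge0 l; lra.
  have [|N HN] := cu (e / (Re `|l| + 1)); first by rewrite divr_gt0.
  exists N => m n Nm Nn; rewrite -scalerBr (seminormZ hp).
  have := HN m n Nm Nn; rewrite ltr_pdivlMr //.
  have := seminorm_ge0 hp (u m - u n); have := Re_norm_ge0 l; nra.
- have [K K0 HK] := seminorm_cauchy_bound cu.
  have [L L0 HL] := seminorm_cauchy_bound cv.
  move=> e e0.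
  have [|N HN] := cu (e / 2 / L); first by rewrite !divr_gt0.
  have [|M HM] := cv (e / 2 / K); first by rewrite !divr_gt0.
  exists (maxn N M) => m n; rewrite !geq_max => /andP[Nm Mm] /andP[Nn Mn].
  have -> : u m ** v m - u n ** v n = u m ** (v m - v n) + (u m - u n) ** v n.
    by rewrite amulBl amulBr addrA subrK.
  rewrite (le_lt_trans (seminormD hp _ _)) //.
  have := HN m n Nm Nn; have := HM m n Mm Mn; rewrite !ltr_pdivlMr // => h1 h2.
  have h3 : p (u m ** (v m - v n)) <= p (v m - v n) * K.
    rewrite (le_trans (seminormM hp _ _)) // mulrC ler_wpM2l ?HK //.
    exact: seminorm_ge0 hp _.
  have h4 : p ((u m - u n) ** v n) <= p (u m - u n) * L.
    rewrite (le_trans (seminormM hp _ _)) // ler_wpM2l ?HL //.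
    exact: seminorm_ge0 hp _.
  lra.
- move=> e /cu[N HN]; exists N => m n Nm Nn.
  by rewrite -starB (seminorm_star hp) HN.
- by move=> e e0; exists 0%N => m n _ _; rewrite subrr (seminorm0 hp).
Qed.

Local Notation S := (subproduct cauchy_closed).

Definition cauchy_seminorm : S -> R := limit_seminorm (fun=> p).

Lemma cauchy_cstar_seminorm : cstar_seminorm cauchy_seminorm.
Proof. exact: limit_cstar_seminorm (fun=> hp) seminorm_cauchy_cvg. Qed.

Definition completion : Type := separated cauchy_cstar_seminorm.

Local Notation T := completion.

HB.instance Definition _ := NormedModule.on T.
HB.instance Definition _ := UnitalStarAlgebra.on T.

Let cls (u : S) : T := sep_class cauchy_cstar_seminorm u.

Lemma cauchy_seminorm_lt (u : S) (e : R) : cauchy_seminorm u < e ->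
  exists N, forall n, (N <= n)%N -> p (terms u n) < e.
Proof.
move=> ue; have : p (terms u n) @[n --> \oo] --> cauchy_seminorm u.
  exact: seminorm_cauchy_cvg (termsP u).
by move=> /cvgr_lt/(_ _ ue)[N _ HN]; exists N => n Nn; exact: HN.
Qed.

Lemma cauchy_seminorm_le (u : S) (e : R) N :
  (forall n, (N <= n)%N -> p (terms u n) <= e) -> cauchy_seminorm u <= e.
Proof.
move=> ue; apply: limr_le; first exact: seminorm_cauchy_cvg (termsP u).
by exists N => // n Nn; exact: ue.
Qed.

Let clsB (u v : S) : `|cls u - cls v| = (cauchy_seminorm (u - v))%:C.
Proof.
have -> : cls u - cls v = cls (u - v).
  by rewrite /cls sep_classD -(scaleN1r v) sep_classZ scaleN1r.
exact: sep_class_norm.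
Qed.

Let completeT (F : set_system T) : ProperFilter F -> cauchy F -> cvg F.
Proof.
move=> FF /cauchyP cF.
pose d n : R := n.+1%:R^-1.
have d0 n : 0 < d n by rewrite invr_gt0.
have [U HU] : {U : nat -> S & forall n, F (ball (cls (U n)) (d n)%:C)}.
  apply: (@choice _ _ (fun n (u : S) => F (ball (cls u) (d n)%:C))) => n.
  have [|x Fx] := cF (d n)%:C; first by rewrite ltcR.
  by have [u xE] := sep_classP x; exists u; rewrite -[cls u]xE.
have [K HK] : {K : nat -> nat & forall n k l, (K n <= k)%N -> (K n <= l)%N ->
    p (terms (U n) k - terms (U n) l) < d n}.
  apply: (@choice _ _ (fun n N => forall k l, (N <= k)%N -> (N <= l)%N ->
    p (terms (U n) k - terms (U n) l) < d n)) => n.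
  by have := termsP (U n); apply.
pose v n := terms (U n) (K n).
have UU n m : cauchy_seminorm (U n - U m) < d n + d m.
  rewrite -ltcR -clsB.
  have [z [zn zm]] := filter_ex (filterI (HU n) (HU m)).
  have -> : cls (U n) - cls (U m) = (cls (U n) - z) + (z - cls (U m)).
    by rewrite addrA subrK.
  rewrite (le_lt_trans (ler_normD _ _)) // rmorphD /= ltrD //.
  by rewrite distrC; move: zm; rewrite -ball_normE.
have vU n m : exists N, forall k, (N <= k)%N ->
    p (v n - terms (U m) k) < d n + (d n + d m).
  have [N HN] := cauchy_seminorm_lt (UU n m).
  exists (maxn N (K n)) => k; rewrite geq_max => /andP[Nk Kk].
  rewrite (le_lt_trans (seminorm_triangle hp _ (terms (U n) k) _)) // ltrD //.
    exact: HK.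
  exact: HN.
have vv n m : p (v n - v m) < d n + (d n + d m) + d m.
  have [N HN] := vU n m.
  have := HN (maxn N (K m)) (leq_maxl _ _).
  have := HK m (maxn N (K m)) (K m) (leq_maxr _ _) (leqnn _).
  have := seminorm_triangle hp (v n) (terms (U m) (maxn N (K m))) (v m).
  by rewrite -/(v m); lra.
have dsmall (e : R) : 0 < e -> exists N, forall n, (N <= n)%N -> d n < e.
  move=> e0; have /cvgrPdist_lt/(_ e e0)[N _ HN] := @cvg_harmonic R.
  exists N => n Nn; have := HN n Nn.
  by rewrite /= sub0r normrN ger0_norm // invr_ge0.
have cv : seminorm_cauchy v.
  move=> e e0; have [|N HN] := dsmall (e / 4); first by rewrite divr_gt0.
  exists N => m n Nm Nn; have := vv m n; have := HN _ Nm; have := HN _ Nn; lra.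
pose V : S := exist _ v cv.
apply/cvg_ex; exists (cls V); apply/cvgrPdist_lt => e /gt0_complex[-> e0].
have [|N HN] := dsmall (Re e / 8); first by rewrite divr_gt0.
have [|M HM] := cv (Re e / 8); first by rewrite divr_gt0.
pose n := maxn N M.
have VU : cauchy_seminorm (V - U n) <= Re e / 2.
  have [L HL] := vU n n.
  apply: (@cauchy_seminorm_le _ _ (maxn L M)) => k.
  rewrite geq_max => /andP[Lk Mk]; rewrite termsB.
  apply: (le_trans (seminorm_triangle hp _ (v n) _)).
  have := HL k Lk; have := HM k n Mk (leq_maxr _ _); have := HN n (leq_maxl _ _).
  by rewrite /=; lra.
apply: filterS (HU n) => z; rewrite -ball_normE /= => zn.
have -> : cls V - z = (cls V - cls (U n)) + (cls (U n) - z).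
  by rewrite addrA subrK.
rewrite (le_lt_trans (ler_normD _ _)) // clsB.
have -> : Re e = Re e / 2 + Re e / 2 by lra.
rewrite rmorphD /= ler_ltD // ?lecR //; apply: (lt_le_trans zn).
by rewrite lecR; have := HN n (leq_maxl _ _); lra.
Qed.

HB.instance Definition _ := Uniform_isComplete.Build T completeT.

Let completion_normM (x y : T) : `|x ** y| <= `|x| * `|y|.
Proof. exact: separated_normM. Qed.

Let completion_normE (x : T) : `|star x ** x| = `|x| ^+ 2.
Proof. exact: separated_normE. Qed.

HB.instance Definition _ := isCStarAlgebra.Build R T
  completion_normM completion_normE.

Lemma const_cauchy (x : P) : seminorm_cauchy (fun=> x).
Proof. by move=> e e0; exists 0%N => m n _ _; rewrite subrr (seminorm0 hp). Qed.

Definition completion_in (x : P) : T := cls (exist _ _ (const_cauchy x)).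

Lemma completion_in_hom : unital_star_hom completion_in.
Proof.
split; first split=> [l x y|x y|x].
- rewrite /completion_in /cls -sep_classZ -sep_classD.
  by congr sep_class; exact: terms_inj.
- rewrite /completion_in /cls -sep_classM.
  by congr sep_class; exact: terms_inj.
- rewrite /completion_in /cls -sep_class_star.
  by congr sep_class; exact: terms_inj.
- by rewrite /completion_in /cls; congr sep_class; exact: terms_inj.
Qed.

End completion.

Section tensor_product.
Context {R : realType}.
Variables A B : unitalCStarAlgType R.

(* The maximal tensor product; when A or B is nuclear, max_seminorm is the    *)
(* only C*-norm on the algebraic tensor product.                              *)
Definition tensor : unitalCStarAlgType R :=
  completion (max_cstar_seminorm A B).

Definition tensor_incl (a : A) : tensor :=
  completion_in (max_cstar_seminorm A B) (simple_tensor a aone).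

Lemma tensor_incl_hom : unital_star_hom tensor_incl.
Proof.
have h := completion_in_hom (max_cstar_seminorm A B).
split; first split=> [l x y|x y|x]; rewrite /tensor_incl.
- by rewrite simple_tensorDl simple_tensorZl (star_hom_linear h).
- by rewrite -(star_homM h) simple_tensorM amul1a.
- by rewrite -(star_hom_star h) simple_tensor_star star1.
- exact: unital_star_hom1 h.
Qed.

End tensor_product.

Section inductive_limit.
Context {R : realType}.
Variables (A : nat -> unitalCStarAlgType R) (f : forall n, A n -> A n.+1).
Hypothesis hf : forall n, unital_star_hom (@f n).

Definition coherent (u : forall n, A n) : Prop :=
  exists N, forall n, (N <= n)%N -> u n.+1 = f (u n).

Lemma coherent_closed : subproduct_closed coherent.
Proof.
split=> [u v [N HN] [M HM]|l u [N HN]|u v [N HN] [M HM]|u [N HN]|].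
- exists (maxn N M) => n; rewrite geq_max => /andP[Nn Mn].
  by rewrite (star_homD (hf n)) HN // HM.
- by exists N => n Nn; rewrite (star_homZ (hf n)) HN.
- exists (maxn N M) => n; rewrite geq_max => /andP[Nn Mn].
  by rewrite (star_homM (hf n)) HN // HM.
- by exists N => n Nn; rewrite (star_hom_star (hf n)) HN.
- by exists 0%N => n _; rewrite (unital_star_hom1 (hf n)).
Qed.

Lemma coherent_cvg u : coherent u -> cvgn (fun n => rnorm (u n)).
Proof.
move=> [N HN]; apply: (@near_nonincreasing_is_cvgn _ _ 0).
  exists N => // m /= Nm n mn.
  elim: n mn => [|n ih]; first by rewrite leqn0 => /eqP ->.
  rewrite leq_eqVlt => /orP[/eqP -> //|mn].
  rewrite (le_trans _ (ih mn)) // HN ?(leq_trans Nm) //.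
  exact: star_hom_contractive (hf n).
by near=> n; exact: rnorm_ge0.
Unshelve. all: by end_near. Qed.

Definition coherent_seminorm : subproduct coherent_closed -> R :=
  limit_seminorm (fun n => @rnorm R (A n)).

Lemma coherent_cstar_seminorm : cstar_seminorm coherent_seminorm.
Proof.
apply: limit_cstar_seminorm => [n|]; last exact: coherent_cvg.
exact: rnorm_cstar_norm.
Qed.

(* Sequences that agree from some rank on are at distance zero, hence         *)
(* identified: this is the completion of the algebraic inductive limit.       *)
Definition inductive_limit : unitalCStarAlgType R :=
  completion coherent_cstar_seminorm.

End inductive_limit.

(* tensor_power A n is the tensor product of n.+1 copies of A. *)
Fixpoint tensor_power (R : realType) (A : unitalCStarAlgType R) (n : nat) :
    unitalCStarAlgType R :=
  if n is m.+1 then tensor (tensor_power A m) A else A.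

Definition infinite_tensor_power (R : realType) (A : unitalCStarAlgType R) :
    unitalCStarAlgType R :=
  inductive_limit (fun n => tensor_incl_hom (tensor_power A n) A).

Definition star_isomorphic (R : realType) (A B : starAlgType R) : Prop :=
  exists f : A -> B, star_hom f /\ bijective f.

(* Main.v *)
Require Import Defs.
From mathcomp Require Import all_boot reals.
From mathcomp Require Import all_order all_algebra complex boolp.
Set Implicit Arguments.
Unset Strict Implicit.
Unset Printing Implicit Defensive.
Import Order.TTheory GRing.Theory Num.Theory.
Local Open Scope ring_scope.

(** Substituting (i) into (ii) gives A (x) A' ~ A and A' (x) A ~ A', and the
    flip identifies A (x) A' with A' (x) A. *)

(** By (i) for A, (ii) for A' at B := A, and (i) again, A ⊗ A' ≅ A^{⊗∞} ⊗ A' ≅ A^{⊗∞} ≅ A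
    ([tensor_absorb]). Exchanging the roles gives A' ⊗ A ≅ A', and the flip closes the chain A ≅ A ⊗
    A' ≅ A' ⊗ A ≅ A'. It remains to see that the completed tensor product respects isomorphism in
    its left factor and is commutative. Both facts hold algebraically ([atensor_isomorphicl],
    [atensorC]) by the universal property. They pass to completions by [tensor_isomorphic], since
    the maximal C*-seminorm is determined by the star-algebra structure. *)

Section isomorphism.
Context {R : realType}.

Lemma star_hom_comp (A B C : starAlgType R) (f : A -> B) (g : B -> C) :
  star_hom f -> star_hom g -> star_hom (g \o f).
Proof.
move=> hf hg; split=> [l x y|x y|x] /=.
- by rewrite (star_hom_linear hf) (star_hom_linear hg).
- by rewrite (star_homM hf) (star_homM hg).
- by rewrite (star_hom_star hf) (star_hom_star hg).
Qed.

Lemma star_hom_can (A B : starAlgType R) (f : A -> B) (g : B -> A) :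
  star_hom f -> cancel f g -> cancel g f -> star_hom g.
Proof.
move=> hf fK gK; split=> [l x y|x y|x]; apply: (can_inj fK).
- by rewrite (star_hom_linear hf) !gK.
- by rewrite (star_homM hf) !gK.
- by rewrite (star_hom_star hf) !gK.
Qed.

Lemma star_isomorphic_sym (A B : starAlgType R) :
  star_isomorphic A B -> star_isomorphic B A.
Proof.
move=> [f [hf [g fK gK]]]; exists g; split; first exact: star_hom_can hf fK gK.
by exists f.
Qed.

Lemma star_isomorphic_trans (A B C : starAlgType R) :
  star_isomorphic A B -> star_isomorphic B C -> star_isomorphic A C.
Proof.
move=> [f [hf bf]] [g [hg bg]]; exists (g \o f).
by split; [exact: star_hom_comp|exact: bij_comp].
Qed.

End isomorphism.

(** The norm of a class is the seminorm of any representative, so equal classes have a difference of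
    seminorm zero. *)
Lemma sep_class_null (R : realType) (P : unitalStarAlgType R) (p : P -> R)
    (hp : cstar_seminorm p) (x y : P) :
  sep_class hp x = sep_class hp y -> p (x - y) = 0.
Proof.
move=> xy; have := sep_class_norm hp (x - y).
by rewrite sep_classD xy -sep_classD subrr sep_class_norm (seminorm0 hp) => -[].
Qed.

(** * Functoriality of completions *)

Section completion_map.
Context {R : realType}.
Variables (P Q : unitalStarAlgType R) (p : P -> R) (q : Q -> R).
Hypotheses (hp : cstar_seminorm p) (hq : cstar_seminorm q).
Variable f : P -> Q.
Hypotheses (hf : star_hom f) (fpq : forall x, q (f x) <= p x).

Lemma star_homB x y : f (x - y) = f x - f y.
Proof. by rewrite (star_homD hf) -scaleN1r (star_homZ hf) scaleN1r. Qed.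

Lemma seminorm_cauchy_map (u : nat -> P) :
  seminorm_cauchy p u -> seminorm_cauchy q (f \o u).
Proof.
move=> cu e /cu[N HN]; exists N => m n Nm Nn /=.
by rewrite -star_homB (le_lt_trans (fpq _)) // HN.
Qed.

Definition cauchy_map (u : subproduct (cauchy_closed hp)) :
    subproduct (cauchy_closed hq) :=
  exist _ _ (seminorm_cauchy_map (termsP u)).

(** The Cauchy representative is picked by choice; [completion_mapE] shows that any other gives the
    same value. *)
Definition completion_map (x : completion hp) : completion hq :=
  sep_class (cauchy_cstar_seminorm hq) (cauchy_map (sval (cid (sep_classP x)))).

(** Contractivity bounds the image sequence termwise, so null sequences go to null sequences. This
    is what makes [completion_map] well defined. *)
Lemma cauchy_map_null u : cauchy_seminorm u = 0 ->
  cauchy_seminorm (cauchy_map u) = 0.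
Proof.
move=> u0; apply: ler_addgt0_eq0 => [|e e0].
  exact: seminorm_ge0 (cauchy_cstar_seminorm hq) _.
have [|N HN] := @cauchy_seminorm_lt _ _ _ hp u e; first by rewrite u0.
apply: (@cauchy_seminorm_le _ _ _ hq _ _ N) => n /HN un /=.
exact: le_trans (fpq _) (ltW un).
Qed.

Lemma completion_mapE u :
  completion_map (sep_class (cauchy_cstar_seminorm hp) u) =
  sep_class (cauchy_cstar_seminorm hq) (cauchy_map u).
Proof.
rewrite /completion_map; case: cid => v /= /esym /sep_class_null vu.
(* The chosen [v] and the given [u] differ by a null sequence, whose image is the difference of the
   images. *)
apply: sep_class_eq; rewrite -[RHS](cauchy_map_null vu); congr cauchy_seminorm.
by apply: terms_inj => n; exact: esym (star_homB _ _).
Qed.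

Lemma completion_map_hom : star_hom completion_map.
Proof.
split=> [l x y|x y|x].
- have [u ->] := sep_classP x; have [v ->] := sep_classP y.
  rewrite -sep_classZ -sep_classD !completion_mapE -sep_classZ -sep_classD.
  by congr sep_class; apply: terms_inj => n; exact: (star_hom_linear hf).
- have [u ->] := sep_classP x; have [v ->] := sep_classP y.
  rewrite -sep_classM !completion_mapE -sep_classM.
  by congr sep_class; apply: terms_inj => n; exact: (star_homM hf).
- have [u ->] := sep_classP x.
  rewrite -sep_class_star !completion_mapE -sep_class_star.
  by congr sep_class; apply: terms_inj => n; exact: (star_hom_star hf).
Qed.

End completion_map.

Section completion_isomorphism.
Context {R : realType}.

(** No density argument is needed: every point of the completion is the class of a Cauchy sequence,
    on which the maps act termwise. *)
Lemma completion_map_can (P Q : unitalStarAlgType R) (p : P -> R) (q : Q -> R)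
    (hp : cstar_seminorm p) (hq : cstar_seminorm q) (f : P -> Q) (g : Q -> P)
    (hf : star_hom f) (fpq : forall x, q (f x) <= p x)
    (hg : star_hom g) (gqp : forall x, p (g x) <= q x) :
  cancel f g ->
  cancel (completion_map (hp := hp) hq hf fpq) (completion_map (hp := hq) hp hg gqp).
Proof.
move=> fK x; have [u ->] := sep_classP x; rewrite !completion_mapE.
by congr sep_class; apply: terms_inj => n /=; rewrite fK.
Qed.

Lemma tensor_isomorphic (A B A' B' : unitalCStarAlgType R) :
  star_isomorphic (atensor A B) (atensor A' B') ->
  star_isomorphic (tensor A B) (tensor A' B').
Proof.
(* Pulling a C*-seminorm back along [f] gives one of the seminorms in the supremum at [x], so every
   star-homomorphism is contractive for the maximal seminorms. *)
have max_le (X Y X' Y' : unitalCStarAlgType R) (f : atensor X Y -> atensor X' Y')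
    (hf : star_hom f) x : max_seminorm (f x) <= max_seminorm x.
  apply: max_seminorm_le => p hp.
  exact: (seminorm_le_max x (seminorm_comp hf hp)).
move=> [f [hf [g fK gK]]]; have hg := star_hom_can hf fK gK.
exists (completion_map (hp := max_cstar_seminorm A B)
  (max_cstar_seminorm A' B') hf (max_le _ _ _ _ _ hf)).
split; first exact: completion_map_hom.
exists (completion_map (hp := max_cstar_seminorm A' B')
  (max_cstar_seminorm A B) hg (max_le _ _ _ _ _ hg)); exact: completion_map_can.
Qed.

End completion_isomorphism.

(** * Maps out of the algebraic tensor product *)

Section algebraic_tensor_maps.
Context {R : realType}.

Lemma atensor_ind (A B : starAlgType R) (T : atensor A B -> Prop) :
  T 0 -> (forall x y, T x -> T y -> T (x + y)) ->
  (forall a b, T (simple_tensor a b)) -> forall x, T x.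
Proof. by move=> T0 TD Ts x; rewrite (atensor_sum x); apply: big_ind. Qed.

Section teval_hom.
Variables (A B T : starAlgType R) (f : A -> B -> T).
Hypotheses (fDl : forall a a' b, f (a + a') b = f a b + f a' b)
  (fDr : forall a b b', f a (b + b') = f a b + f a b')
  (fZl : forall (l : R[i]) a b, f (l *: a) b = l *: f a b)
  (fZr : forall (l : R[i]) a b, f a (l *: b) = l *: f a b)
  (fM : forall a b a' b', f (a ** a') (b ** b') = f a b ** f a' b')
  (f_star : forall a b, f (star a) (star b) = star (f a b)).

Lemma bilinear_balanced : balanced f.
Proof. by split=> // l a b; rewrite fZl fZr. Qed.

Let bf := bilinear_balanced.

(** Universal property for star-algebras: [teval f] is additive because [f] is balanced, so each
    remaining identity need only be checked on simple tensors. *)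
Lemma teval_hom : star_hom (teval f).
Proof.
have f0 : teval f 0 = 0 by exact: teval_zero.
split=> [l x y|x y|x].
(* Only homogeneity is left; on a simple tensor the scalar moves into the left leg. *)
- rewrite teval_linD //; congr (_ + _); elim/atensor_ind: x => [|x z ihx ihz|a b].
  + by rewrite scaler0 f0 scaler0.
  + by rewrite scalerDr !teval_linD // ihx ihz scalerDr.
  + by rewrite -simple_tensorZl !teval_simple.
- elim/atensor_ind: x => [|x z ihx ihz|a b].
  + by rewrite amul0l f0 amul0l.
  + by rewrite amulDl !teval_linD // ihx ihz amulDl.
  elim/atensor_ind: y => [|y z ihy ihz|c d].
  + by rewrite amul0r f0 amul0r.
  + by rewrite amulDr !teval_linD // ihy ihz amulDr.
  + by rewrite simple_tensorM !teval_simple.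
- elim/atensor_ind: x => [|x z ihx ihz|a b].
  + by rewrite star0 f0 star0.
  + by rewrite starD !teval_linD // ihx ihz starD.
  + by rewrite simple_tensor_star !teval_simple.
Qed.

End teval_hom.

Lemma star_hom_atensor_ext (A B T : starAlgType R) (f g : atensor A B -> T) :
  star_hom f -> star_hom g ->
  (forall a b, f (simple_tensor a b) = g (simple_tensor a b)) -> f =1 g.
Proof.
move=> hf hg fg; elim/atensor_ind => [|x y fx fy|] //.
  by rewrite (star_hom0 hf) (star_hom0 hg).
by rewrite (star_homD hf) (star_homD hg) fx fy.
Qed.

Lemma star_hom_id (A : starAlgType R) : star_hom (@id A).
Proof. by split. Qed.

Section map_left.
Variables (A A' B : starAlgType R) (f : A -> A') (hf : star_hom f).

Let g a (b : B) := simple_tensor (f a) b.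

(** This is f ⊗ id, obtained from the universal property. *)
Lemma atensor_mapl : exists2 h : atensor A B -> atensor A' B, star_hom h &
  forall a b, h (simple_tensor a b) = simple_tensor (f a) b.
Proof.
have gDl a a' b : g (a + a') b = g a b + g a' b.
  by rewrite /g (star_homD hf) simple_tensorDl.
have gDr a b b' : g a (b + b') = g a b + g a b' by exact: simple_tensorDr.
have gZl (l : R[i]) a b : g (l *: a) b = l *: g a b.
  by rewrite /g (star_homZ hf) simple_tensorZl.
have gZr (l : R[i]) a b : g a (l *: b) = l *: g a b by exact: simple_tensorZr.
exists (teval g) => [|a b]; last exact/teval_simple/bilinear_balanced.
apply: teval_hom => // [a b a' b'|a b].
  by rewrite /g simple_tensorM (star_homM hf).
by rewrite /g simple_tensor_star (star_hom_star hf).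
Qed.

End map_left.

Lemma atensor_flip (A B : starAlgType R) :
  exists2 h : atensor A B -> atensor B A, star_hom h &
    forall a b, h (simple_tensor a b) = simple_tensor b a.
Proof.
pose g (a : A) (b : B) := simple_tensor b a.
have gDl a a' b : g (a + a') b = g a b + g a' b by exact: simple_tensorDr.
have gDr a b b' : g a (b + b') = g a b + g a b' by exact: simple_tensorDl.
have gZl (l : R[i]) a b : g (l *: a) b = l *: g a b by exact: simple_tensorZr.
have gZr (l : R[i]) a b : g a (l *: b) = l *: g a b by exact: simple_tensorZl.
exists (teval g) => [|a b]; last exact/teval_simple/bilinear_balanced.
apply: teval_hom => // [a b a' b'|a b].
  by rewrite /g simple_tensorM.
by rewrite /g simple_tensor_star.
Qed.

(** The composite and the identity are star-homomorphisms, hence equal once they agree on simple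
    tensors. *)
Lemma atensor_can (A B A' B' : starAlgType R) (f : atensor A B -> atensor A' B')
    (g : atensor A' B' -> atensor A B) :
  star_hom f -> star_hom g ->
  (forall a b, g (f (simple_tensor a b)) = simple_tensor a b) -> cancel f g.
Proof.
by move=> hf hg; apply: star_hom_atensor_ext (star_hom_comp hf hg) (star_hom_id _).
Qed.

Lemma atensor_isomorphicl (A A' B : starAlgType R) :
  star_isomorphic A A' -> star_isomorphic (atensor A B) (atensor A' B).
Proof.
move=> [f [hf [g fK gK]]].
have [F hF FE] := atensor_mapl B hf.
have [G hG GE] := atensor_mapl B (star_hom_can hf fK gK).
exists F; split=> //; exists G; apply: atensor_can => // a b.
  by rewrite FE GE fK.
by rewrite GE FE gK.
Qed.

Lemma atensorC (A B : starAlgType R) :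
  star_isomorphic (atensor A B) (atensor B A).
Proof.
have [F hF FE] := atensor_flip A B; have [G hG GE] := atensor_flip B A.
exists F; split=> //; exists G; apply: atensor_can => // a b.
  by rewrite FE GE.
by rewrite GE FE.
Qed.

End algebraic_tensor_maps.

(** * Absorption and uniqueness *)

Lemma tensor_absorb (R : realType) (A I A' : unitalCStarAlgType R) :
  star_isomorphic I A -> star_isomorphic (tensor I A') I ->
  star_isomorphic (tensor A A') A.
Proof.
move=> IA IA'; apply: (star_isomorphic_trans (B := tensor I A')).
  exact/tensor_isomorphic/atensor_isomorphicl/star_isomorphic_sym.
exact: star_isomorphic_trans IA' IA.
Qed.

Theorem mainTheorem5 (R : realType) (C : unitalCStarAlgType R -> Prop)
    (C_nuclear : forall B : unitalCStarAlgType R, C B -> nuclear B)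
    (A A' : unitalCStarAlgType R)
    (CA : C A)
    (A_i : star_isomorphic (infinite_tensor_power A) A)
    (A_ii : forall B : unitalCStarAlgType R, C B ->
      star_isomorphic (tensor (infinite_tensor_power B) A)
                      (infinite_tensor_power B))
    (CA' : C A')
    (A'_i : star_isomorphic (infinite_tensor_power A') A')
    (A'_ii : forall B : unitalCStarAlgType R, C B ->
      star_isomorphic (tensor (infinite_tensor_power B) A')
                      (infinite_tensor_power B)) :
  star_isomorphic A A'.
Proof.
(* Each algebra's condition (ii) is used at the other algebra. *)
have AA' := tensor_absorb A_i (A'_ii A CA).
have A'A := tensor_absorb A'_i (A_ii A' CA').
(* A ≅ A ⊗ A' ≅ A' ⊗ A ≅ A', with the flip in the middle. *)
apply: star_isomorphic_trans (star_isomorphic_sym AA') _.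
exact: star_isomorphic_trans (tensor_isomorphic (atensorC A A')) A'A.
Qed.
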